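(* Let $N\in\mathbb{N}$. Then \begin{equation*} \sum_{n=1}^{N}\frac{q^n(q^{n+1})_{N-n}}{(q^{2n};q^2)_{N-n+1}} = \frac{1}{(q)_N}\sum_{n = 1}^{N} \genfrac{[}{]}{0pt}{}{N}{n}\frac{(-1)^{n - 1}nq^{n(n + 1)/2}}{1 + q^n}. \end{equation*}
   Context: Here $|q|<1$, $(A)_n=(A;q)_n=(1-A)(1-Aq)\cdots(1-Aq^{n-1})$, $(A;q^2)_n$ is defined analogously with base $q^2$, and $\genfrac{[}{]}{0pt}{}{N}{n}=\frac{(q;q)_N}{(q;q)_n(q;q)_{N-n}}$ is the $q$-binomial coefficient. *)

(* Defs.v *)
From mathcomp Require Import all_boot all_order all_algebra.
From mathcomp Require Import reals complex.

Set Implicit Arguments.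
Unset Strict Implicit.
Unset Printing Implicit Defensive.

Import GRing.Theory Num.Theory.
Local Open Scope ring_scope.

(* (a; b)_n, with base b *)
Definition qpoch (F : fieldType) (a b : F) (n : nat) : F :=
  \prod_(0 <= k < n) (1 - a * b ^+ k).

(* Used only for n <= N; the truncated N - n makes other values meaningless. *)
Definition qbinom (F : fieldType) (q : F) (N n : nat) : F :=
  qpoch q q N / (qpoch q q n * qpoch q q (N - n)).

(* Main.v *)
Require Import Defs.
From mathcomp Require Import all_boot all_order all_algebra.
From mathcomp Require Import reals complex.
From mathcomp Require Import zify ring.

Import GRing.Theory Num.Theory.
Local Open Scope ring_scope.
Local Open Scope complex_scope.

(** Both sides satisfy (1 + q^N) X_N = X_(N-1) + q^N / (1 - q^N), X_0 = 0.
    On the left every summand is divided by 1 + q^N when passing from N - 1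
    to N. On the right, after cancelling (q)_N, the identity
    (1 + q^N) - (1 - q^(N-n)) = q^(N-n) (1 + q^n) removes the factor
    1 / (1 + q^n), and what remains is the derivative at z = 1 of the
    q-binomial theorem sum_n [N, n] (-1)^n q^(n(n-1)/2) z^n = (z)_N. *)

Lemma qpochS (F : fieldType) (a b : F) (n : nat) :
  qpoch a b n.+1 = qpoch a b n * (1 - a * b ^+ n).
Proof. by rewrite /qpoch big_nat_recr. Qed.

Lemma qpoch0 (F : fieldType) (a b : F) : qpoch a b 0 = 1.
Proof. by rewrite /qpoch big_nil. Qed.

Section NotRootOfUnity.

Variables (F : fieldType) (q : F).
Hypothesis q_neq1 : forall k, q ^+ k.+1 != 1.

Lemma one_sub_qX_neq0 k : 1 - q ^+ k.+1 != 0.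
Proof. by rewrite subr_eq0 eq_sym. Qed.

(** Squaring [q ^+ k.+1 = -1] would give a positive power of [q] equal to 1. *)
Lemma one_add_qX_neq0 k : 1 + q ^+ k.+1 != 0.
Proof.
apply: contra (q_neq1 (k.+1 * 2).-1) => /eqP eq0.
have -> : q ^+ (k.+1 * 2).-1.+1 = (q ^+ k.+1) ^+ 2 by rewrite -exprM.
apply/eqP; have -> : q ^+ k.+1 = -1 by apply/eqP; rewrite -addr_eq0 addrC eq0.
by rewrite sqrrN expr1n.
Qed.

Lemma qpochqS n : qpoch q q n.+1 = qpoch q q n * (1 - q ^+ n.+1).
Proof. by rewrite qpochS exprS. Qed.

Lemma qpochq_neq0 n : qpoch q q n != 0.
Proof.
elim: n => [|n IHn]; first by rewrite qpoch0 oner_neq0.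
by rewrite qpochqS mulf_neq0 // one_sub_qX_neq0.
Qed.

(** For [w n = z ^+ n] this is the q-binomial sum divided by (q)_N, that is (z)_N / (q)_N; general
    weights make its z-derivative available. *)
Definition qalt (w : nat -> F) (N : nat) : F :=
  \sum_(n < N.+1)
    w n * ((-1) ^+ n * q ^+ 'C(n, 2) / (qpoch q q n * qpoch q q (N - n))).

(** A q-Pascal rule: 1 - q^(N+1) = (1 - q^(N+1-n)) + q^(N+1-n) (1 - q^n), and each part shortens one
    Pochhammer symbol in the denominator. *)
Lemma qaltS w N :
  (1 - q ^+ N.+1) * qalt w N.+1
  = qalt w N - q ^+ N * qalt (fun n => w n.+1) N.
Proof.
pose c n := w n * ((-1) ^+ n * q ^+ 'C(n, 2)
                   / (qpoch q q n * qpoch q q (N.+1 - n))).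
have split_term (n : 'I_N.+2) : (1 - q ^+ N.+1) * c n =
    (1 - q ^+ (N.+1 - n)) * c n + q ^+ (N.+1 - n) * (1 - q ^+ n) * c n.
  rewrite -mulrDl mulrBr mulr1 -exprD subnK; last by rewrite -ltnS.
  by congr (_ * _); ring.
rewrite /qalt mulr_sumr (eq_bigr _ (fun n _ => split_term n)) big_split /=.
congr (_ + _).
  rewrite big_ord_recr /= subnn expr0 subrr mul0r addr0.
  apply: eq_bigr => -[n /= le_nN] _; rewrite /c subSn // qpochqS.
  have := qpochq_neq0 n; have := qpochq_neq0 (N - n).
  have := one_sub_qX_neq0 (N - n).
  by move=> *; field; apply/and3P; split.
(* The term n = 0 vanishes; after the shift, q^(N-n) and the extra q^n from 'C(n+1, 2) combine to
   q^N. *)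
rewrite big_ord_recl /= expr0 subrr mulr0 mul0r add0r mulr_sumr -sumrN.
apply: eq_bigr => -[n /= le_nN] _; rewrite /c /bump /= add1n subSS qpochqS.
have -> : 'C(n.+1, 2) = ('C(n, 2) + n)%N by rewrite binS bin1.
rewrite -[in RHS](subnK (le_nN : (n <= N)%N)) !exprD addnK [(-1) ^+ n.+1]exprS.
have := qpochq_neq0 n; have := qpochq_neq0 (N - n); have := one_sub_qX_neq0 n.
by move=> *; field; apply/and3P; split.
Qed.

Lemma qalt0 w : qalt w 0 = w 0%N.
Proof.
by rewrite /qalt big_ord_recr big_ord0 /= add0r qpoch0 !mulr1 divr1 mulr1.
Qed.

Lemma qaltD w1 w2 N : qalt (fun n => w1 n + w2 n) N = qalt w1 N + qalt w2 N.
Proof. by rewrite /qalt -big_split; apply: eq_bigr => n _; rewrite mulrDl. Qed.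

(** The case z = 1: the factor 1 - q^0 in the recurrence kills the first value, and zero
    propagates. *)
Lemma qalt_one N : qalt (fun=> 1) N.+1 = 0.
Proof.
have step M : (1 - q ^+ M.+1) * qalt (fun=> 1) M.+1 =
    (1 - q ^+ M) * qalt (fun=> 1) M.
  by rewrite qaltS mulrBl mul1r.
apply: (mulfI (one_sub_qX_neq0 N)); rewrite mulr0.
elim: N => [|N IHN]; first by rewrite step expr0 subrr mul0r.
by rewrite step.
Qed.

(** The derivative of (z)_(N+1) / (q)_(N+1) at z = 1. In the recurrence, the correction
    [qalt (fun=> 1) M] contributes only at M = 0. *)
Lemma qalt_natr N : (1 - q ^+ N.+1) * qalt (fun n => n%:R) N.+1 = -1.
Proof.
have step M : (1 - q ^+ M.+1) * qalt (fun n => n%:R) M.+1 =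
    (1 - q ^+ M) * qalt (fun n => n%:R) M - q ^+ M * qalt (fun=> 1) M.
  have qaltE : qalt (fun n => n.+1%:R) M =
      qalt (fun n => n%:R) M + qalt (fun=> 1) M.
    by rewrite -qaltD; apply: eq_bigr => n _; rewrite -natr1.
  by rewrite qaltS qaltE; ring.
elim: N => [|N IHN]; first by rewrite step !qalt0 expr0 mulr0 mul1r sub0r.
by rewrite step IHN qalt_one mulr0 subr0.
Qed.

Definition lhs_sum (N : nat) : F :=
  \sum_(1 <= n < N.+1)
     q ^+ n * qpoch (q ^+ n.+1) q (N - n)
       / qpoch (q ^+ (2 * n)) (q ^+ 2) (N - n + 1).

Definition rhs_sum (N : nat) : F :=
  (qpoch q q N)^-1 *
    \sum_(1 <= n < N.+1)
       qbinom q N n *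
       ((-1) ^+ (n - 1) * n%:R * q ^+ ((n * (n + 1)) %/ 2) / (1 + q ^+ n)).

Lemma lhs_sumS N :
  (1 + q ^+ N.+1) * lhs_sum N.+1
  = lhs_sum N + q ^+ N.+1 / (1 - q ^+ N.+1).
Proof.
have pN := one_add_qX_neq0 N; have mN := one_sub_qX_neq0 N.
have sqE : 1 - q ^+ (2 * N.+1) = (1 - q ^+ N.+1) * (1 + q ^+ N.+1).
  by rewrite mulnC exprM; ring.
rewrite /lhs_sum big_nat_recr //= mulrDr mulr_sumr; congr (_ + _).
  apply: eq_big_nat => n /andP[_ le_nN].
  rewrite subSn // addSn !qpochS -exprM -!exprD.
  have -> : (n.+1 + (N - n) = N.+1)%N by lia.
  have -> : (2 * n + 2 * (N - n + 1) = 2 * N.+1)%N by lia.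
  (* With the inverse of the common base-q^2 symbol generalized, [field] only asks that 1 - q^(N+1)
     and 1 + q^(N+1) be nonzero. *)
  rewrite sqE invfM; move: (_^-1) => X; rewrite invfM.
  by field; apply/andP; split.
rewrite subnn qpochS !qpoch0 expr0 !mulr1 mul1r sqE.
by field; apply/andP; split.
Qed.

Lemma rhs_sumE N :
  rhs_sum N = - \sum_(n < N.+1)
    n%:R * ((-1) ^+ n * q ^+ 'C(n, 2) / (qpoch q q n * qpoch q q (N - n)))
      * (q ^+ n / (1 + q ^+ n)).
Proof.
rewrite big_ord_recl /= !mul0r add0r /rhs_sum big_add1 /= big_mkord mulr_sumr.
rewrite -sumrN; apply: eq_bigr => -[n /= _] _.
rewrite /bump /= add1n /qbinom subn1 /=.
have -> : ((n.+1 * (n.+1 + 1)) %/ 2 = 'C(n.+1, 2) + n.+1)%N.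
  by rewrite addn1 divn2 mulnC -[X in (_ * X)./2]/(n.+2.-1) -bin2 binS bin1.
rewrite exprD [(-1) ^+ n.+1]exprS.
have := qpochq_neq0 N; have := qpochq_neq0 n.+1.
have := qpochq_neq0 (N - n.+1); have := one_add_qX_neq0 n.
by move=> *; field; apply/and4P; split.
Qed.

Lemma rhs_sumS N :
  (1 + q ^+ N.+1) * rhs_sum N.+1
  = rhs_sum N + q ^+ N.+1 / (1 - q ^+ N.+1).
Proof.
have mN := one_sub_qX_neq0 N.
(* Written as a [qalt] sum, the inhomogeneous term lets the recurrence be checked term by term. *)
have -> : q ^+ N.+1 / (1 - q ^+ N.+1) =
    - (q ^+ N.+1 * qalt (fun n => n%:R) N.+1).
  by apply: (mulIf mN); rewrite divfK // mulNr -mulrA [qalt _ _ * _]mulrC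
     qalt_natr mulrN1 opprK.
rewrite !rhs_sumE mulrN -opprD; congr (- _).
rewrite /qalt big_ord_recr [X in _ = _ + _ * X]big_ord_recr /= !mulrDr addrA.
rewrite !mulr_sumr -big_split /=; congr (_ + _).
  (* n = 0 is separate: 1 + q^0 = 2 may vanish in [F], but the weight 0 kills the term. *)
  apply: eq_bigr => -[[|n] /= le_nN] _; first by rewrite !mul0r !mulr0 addr0.
  rewrite subSn // (qpochqS (N - _)).
  have -> : q ^+ N.+1 = q ^+ (N - n.+1).+1 * q ^+ n.+1.
    by rewrite -exprD; congr (_ ^+ _); lia.
  have := qpochq_neq0 n.+1; have := qpochq_neq0 (N - n.+1).
  have := one_add_qX_neq0 n; have := one_sub_qX_neq0 (N - n.+1).
  by move=> *; field; apply/and4P; split.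
rewrite subnn qpoch0; have := qpochq_neq0 N.+1; have := one_add_qX_neq0 N.
by move=> *; field; apply/andP; split.
Qed.

Lemma lhs_sum_eq_rhs_sum N : lhs_sum N = rhs_sum N.
Proof.
elim: N => [|N IHN]; first by rewrite /lhs_sum /rhs_sum !big_geq // mulr0.
by apply: (mulfI (one_add_qX_neq0 N)); rewrite lhs_sumS rhs_sumS IHN.
Qed.

End NotRootOfUnity.

Theorem theorem6p3 (R : realType) (q : R[i]) (hq : `|q| < 1) (N : nat) :
  \sum_(1 <= n < N.+1)
     q ^+ n * qpoch (q ^+ n.+1) q (N - n)
       / qpoch (q ^+ (2 * n)) (q ^+ 2) (N - n + 1)
  = (qpoch q q N)^-1 *
    \sum_(1 <= n < N.+1)
       qbinom q N n *
       ((-1) ^+ (n - 1) * n%:R * q ^+ ((n * (n + 1)) %/ 2) / (1 + q ^+ n)).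
Proof.
apply: lhs_sum_eq_rhs_sum => k; apply/eqP => qk1.
have : `|q| ^+ k.+1 < 1 by rewrite exprn_ilt1.
by rewrite -normrX qk1 normr1 Order.POrderTheory.ltxx.
Qed.
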